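(* Let $\mathbb{Y}$ be a subspace of $\ell_1^n$ and let $\mathcal{A}=\{\widetilde{a_1},\ldots,\widetilde{a_m}\}$ be a basis of $\mathbb{Y}$ with $|\mathcal{Z}_{\mathcal{A}}|=r>0$. Let $\widetilde{b}\in\ell_1^n$ be such that there exists no best coapproximation to $\sigma(\widetilde{b})$ out of $\sigma(\mathbb{Y})=\mathrm{span}\{\sigma(\widetilde{a_1}),\ldots,\sigma(\widetilde{a_m})\}$. Then there exists $\delta_0>0$ such that: (i) for any $y\in\mathcal{P}_{\widetilde{b}}$ with $\|y-\rho(\widetilde{b})\|<\delta_0$, there exists no best coapproximation to $y$ out of $\mathbb{Y}$; (ii) for any $y\in\mathcal{P}_{\widetilde{b}}$ with $\|y-\rho(\widetilde{b})\|\ge\delta_0$, there exists a best coapproximation to $y$ out of $\mathbb{Y}$.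
   Context: $\ell_1^n$ is $\mathbb{R}^n$ with the norm $\sum_i|x_i|$. For a linearly independent set $\mathcal{A}=\{\widetilde{a_1},\ldots,\widetilde{a_m}\}$ in $\ell_1^n$ with $\widetilde{a_k}=(a^k_1,\ldots,a^k_n)$, the zero set is $\mathcal{Z}_{\mathcal{A}}=\{i\in\{1,\ldots,n\}:(a_i^1,\ldots,a_i^m)=(0,\ldots,0)\}$. Let $r=|\mathcal{Z}_{\mathcal{A}}|$ and $k=n-r$. The linear map $\rho:\ell_1^n\to\ell_1^n$ sends $(b_1,\ldots,b_n)$ to $(c_1,\ldots,c_n)$, where $c_i=b_i$ for $i\notin\mathcal{Z}_{\mathcal{A}}$ and $c_i=0$ for $i\in\mathcal{Z}_{\mathcal{A}}$. The linear map $\sigma:\ell_1^n\to\ell_1^k$ deletes the coordinates indexed by $\mathcal{Z}_{\mathcal{A}}$: $\sigma(b_1,\ldots,b_n)=(b_{i_1},\ldots,b_{i_k})$, where $i_1<\cdots<i_k$ are the elements of $\{1,\ldots,n\}\setminus\mathcal{Z}_{\mathcal{A}}$. For $\widetilde{b}=(b_1,\ldots,b_n)\in\ell_1^n$, $\mathcal{P}_{\widetilde{b}}=\{(y_1,\ldots,y_n)\in\ell_1^n: y_i=b_i\ \text{for all } i\notin\mathcal{Z}_{\mathcal{A}}\}$. An element $y_0\in\mathbb{Y}$ is a best coapproximation to $x$ out of $\mathbb{Y}$ if $\|y_0-y\|\le\|x-y\|$ for all $y\in\mathbb{Y}$. *)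

(* Defs.v *)
From HB Require Import structures.
From mathcomp Require Import all_boot all_order all_algebra.
From mathcomp Require Import reals.
Set Implicit Arguments.
Unset Strict Implicit.
Unset Printing Implicit Defensive.
Import Order.TTheory GRing.Theory Num.Theory.
Local Open Scope ring_scope.

(* The space l_1^n is 'rV[R]_n with the norm below; the
   library norm on matrices is the sup norm. *)
Definition l1norm (R : realType) (n : nat) (x : 'rV[R]_n) : R :=
  \sum_(i < n) `|x 0 i|.

Definition best_coapprox (R : realType) (n : nat) (Y : {vspace 'rV[R]_n})
    (x y0 : 'rV[R]_n) : Prop :=
  y0 \in Y /\ forall y, y \in Y -> l1norm (y0 - y) <= l1norm (x - y).

Definition zero_set (R : realType) (n m : nat) (A : m.-tuple 'rV[R]_n) :
    {set 'I_n} :=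
  [set i | [forall k : 'I_m, tnth A k 0 i == 0]].

Definition rho (R : realType) (n : nat) (Z : {set 'I_n}) (b : 'rV[R]_n) :
    'rV[R]_n :=
  \row_i (if i \in Z then 0 else b 0 i).

(* The dimension k = n - r of the target of sigma is written #|~: Z|. *)
Lemma card_setC_sub (n : nat) (Z : {set 'I_n}) : #|~: Z| = (n - #|Z|)%N.
Proof. by rewrite cardsCs setCK card_ord. Qed.

(* enum_val lists the elements i_1 < ... < i_k of ~: Z in increasing order. *)
Definition sigma (R : realType) (n : nat) (Z : {set 'I_n}) (b : 'rV[R]_n) :
    'rV[R]_#|~: Z| :=
  \row_(j < #|~: Z|) b 0 (enum_val j).

Lemma sigma_is_linear (R : realType) (n : nat) (Z : {set 'I_n}) :
  linear (@sigma R n Z).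
Proof. by move=> a u v; apply/rowP => j; rewrite !mxE. Qed.

HB.instance Definition _ (R : realType) (n : nat) (Z : {set 'I_n}) :=
  GRing.isLinear.Build R 'rV[R]_n 'rV[R]_#|~: Z| _ (@sigma R n Z)
    (@sigma_is_linear R n Z).

Definition sigma_img (R : realType) (n : nat) (Z : {set 'I_n})
    (Y : {vspace 'rV[R]_n}) : {vspace 'rV[R]_#|~: Z|} :=
  (linfun (@sigma R n Z) @: Y)%VS.

Lemma mem_sigma_img (R : realType) (n : nat) (Z : {set 'I_n})
    (Y : {vspace 'rV[R]_n}) (w : 'rV[R]_#|~: Z|) :
  w \in sigma_img Z Y <-> exists2 v, v \in Y & w = sigma Z v.
Proof.
split=> [/memv_imgP[v vY ->]|[v vY ->]]; first by exists v; rewrite ?lfunE.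
by apply/memv_imgP; exists v; rewrite ?lfunE.
Qed.

Lemma sigma_img_span (R : realType) (n m : nat) (Z : {set 'I_n})
    (Y : {vspace 'rV[R]_n}) (A : m.-tuple 'rV[R]_n) :
  basis_of Y A -> sigma_img Z Y = <<[seq sigma Z a | a <- A]>>%VS.
Proof.
move=> /span_basis <-; rewrite /sigma_img limg_span.
by congr (<<_>>)%VS; apply: eq_map => a; rewrite lfunE.
Qed.

Definition slice (R : realType) (n : nat) (Z : {set 'I_n}) (b y : 'rV[R]_n) :
    Prop :=
  forall i, i \notin Z -> y 0 i = b 0 i.

(* Main.v *)
Require Import Defs.
From mathcomp Require Import all_boot all_order all_algebra.
From mathcomp Require Import reals.
From mathcomp Require classical_sets topology normedtype derive.
Set Implicit Arguments.
Unset Strict Implicit.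
Unset Printing Implicit Defensive.
Import Order.TTheory GRing.Theory Num.Theory.
Local Open Scope ring_scope.

(** For [y] in the slice and [v] in [Y], the vectors [rho b - v] and
    [y - rho b] have disjoint supports, so
    [|y - v| = |rho b - v| + |y - rho b|]. Hence [y] has a best coapproximation
    iff some [y0] in [Y] satisfies [|y0 - v| <= |rho b - v| + t] for all [v] in
    [Y], where [t = |y - rho b|]. The threshold [delta0] is the least such [t],
    which is attained by compactness; if it were [<= 0], then [sigma y0] would
    be a best coapproximation to [sigma b]. *)

Section L1Norm.
Variables (R : realType) (n : nat).
Implicit Types (x y z : 'rV[R]_n) (c : R).

Lemma l1norm0 : l1norm (0 : 'rV[R]_n) = 0.
Proof. by rewrite /l1norm big1 // => i _; rewrite mxE normr0. Qed.

Lemma l1norm_ge0 x : 0 <= l1norm x.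
Proof. exact: sumr_ge0. Qed.

Lemma l1normD x y : l1norm (x + y) <= l1norm x + l1norm y.
Proof.
by rewrite /l1norm -big_split /= ler_sum // => i _; rewrite mxE ler_normD.
Qed.

Lemma l1normN x : l1norm (- x) = l1norm x.
Proof. by apply: eq_bigr => i _; rewrite mxE normrN. Qed.

Lemma l1normZ c x : l1norm (c *: x) = `|c| * l1norm x.
Proof.
by rewrite /l1norm mulr_sumr; apply: eq_bigr => i _; rewrite mxE normrM.
Qed.

Lemma l1norm_distD z x y : l1norm (x - y) <= l1norm (x - z) + l1norm (z - y).
Proof. by rewrite -[x - y](subrKA z) l1normD. Qed.

Lemma ler_coord_l1norm x i : `|x 0 i| <= l1norm x.
Proof. by rewrite /l1norm (bigD1 i) //= lerDl sumr_ge0. Qed.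

End L1Norm.

Section Compactness.
Import classical_sets topology normedtype derive.
Import numFieldNormedType.Exports.
Local Open Scope classical_set_scope.
Local Open Scope ring_scope.

(** Expand [x] in the standard basis: each coordinate is at most [l1norm x], so the images of the
    basis vectors supply the constant. *)
Lemma l1norm_linear_bounded (R : realType) (n p : nat)
    (f : {linear 'rV[R]_n -> 'rV[R]_p}) :
  exists C : R, forall x, l1norm (f x) <= C * l1norm x.
Proof.
exists (\sum_i l1norm (f (delta_mx 0 i))) => x.
rewrite {1}(row_sum_delta x) linear_sum mulr_suml.
apply: (@le_trans _ _ (\sum_i l1norm (f (x 0 i *: delta_mx 0 i)))).
  elim/big_ind2: _ => [|u c v d uc vd|//]; first by rewrite l1norm0.
  exact: le_trans (l1normD _ _) (lerD uc vd).
apply: ler_sum => i _; rewrite linearZ l1normZ mulrC.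
by rewrite ler_wpM2l ?l1norm_ge0 ?ler_coord_l1norm.
Qed.

Lemma ler_l1norm_mx_norm (R : realType) (n : nat) (x : 'rV[R]_n) :
  l1norm x <= n%:R * `|x|.
Proof.
have -> : n%:R * `|x| = \sum_(i < n) `|x|.
  by rewrite sumr_const card_ord mulr_natl.
apply: ler_sum => i _; rewrite [leRHS]/Num.norm /= mx_normrE.
exact: (@le_bigmax _ _ _ _ (fun ij => `|x ij.1 ij.2|) (0, i)).
Qed.

(** Continuity refers to the sup norm, which dominates [l1norm] up to the factor [n]. The one-sided
    bound suffices, since [x] and [y] can be exchanged. *)
Lemma l1norm_lipschitz_continuous (R : realType) (n : nat)
    (h : 'rV[R]_n -> R) (C : R) :
  (forall x y, h x - h y <= C * l1norm (x - y)) -> continuous h.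
Proof.
(* [C] may be negative and [n] may be 0; the absolute value and the added 1 keep [K] positive. *)
move=> hC x; pose K := `|C| * n%:R + 1.
have K0 : 0 < K by rewrite ltr_wpDl // mulr_ge0.
have hK y z : h y - h z <= K * `|y - z|.
  apply: le_trans (hC _ _) _; apply: (@le_trans _ _ (`|C| * l1norm (y - z))).
    by rewrite ler_wpM2r ?l1norm_ge0 ?ler_norm.
  apply: le_trans (ler_wpM2l (normr_ge0 C) (ler_l1norm_mx_norm _)) _.
  by rewrite mulrA ler_wpM2r // lerDl.
apply/(@cvgrPdist_le _ _ _ (nbhs x)) => e e0; near=> y.
have xy : `|x - y| <= e / K.
  by near: y; apply: cvgr_dist_le; [exact: cvg_id | exact: divr_gt0].
apply: (@le_trans _ _ (K * `|x - y|)); last by rewrite mulrC -ler_pdivlMr.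
by rewrite ler_norml hK andbT lerNl opprB distrC hK.
Unshelve. all: by end_near. Qed.

(** The least admissible excess of [y] is a supremum of 1-Lipschitz functions of [y], hence
    continuous. It is large far from 0, so its minimum over [Y] can be sought in a compact box. *)
Lemma optimal_coapprox (R : realType) (n : nat) (Y : {vspace 'rV[R]_n})
    (w : 'rV[R]_n) :
  exists2 d : R,
    exists2 y0, y0 \in Y &
      forall v, v \in Y -> l1norm (y0 - v) <= l1norm (w - v) + d &
    forall y t, y \in Y ->
      (forall v, v \in Y -> l1norm (y - v) <= l1norm (w - v) + t) -> d <= t.
Proof.
(* [g x] is the least [t] admissible for [x]. The supremum is finite although [Y] is unbounded,
   because the triangle inequality bounds every difference by [l1norm (x - w)]. *)
pose E x := [set l1norm (x - v) - l1norm (w - v) | v in [set v | v \in Y]].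
pose g x := sup (E x).
have E_neq0 x : E x !=set0.
  by apply: image_nonempty; exists 0; exact: mem0v.
have E_ub x : ubound (E x) (l1norm (x - w)).
  by move=> _ [v _ <-]; rewrite lerBlDr l1norm_distD.
have le_g x v : v \in Y -> l1norm (x - v) <= l1norm (w - v) + g x.
  move=> vY; rewrite -lerBlDl; apply: ub_le_sup.
    by exists (l1norm (x - w)).
  by exists v.
have g_le x t :
    (forall v, v \in Y -> l1norm (x - v) <= l1norm (w - v) + t) -> g x <= t.
  by move=> xt; apply: ge_sup => // _ [v vY <-]; rewrite lerBlDl xt.
have g_lip x y : g x - g y <= l1norm (x - y).
  rewrite lerBlDr; apply: g_le => v vY.
  apply: le_trans (l1norm_distD y _ _) _.
  by rewrite addrCA lerD2l le_g.
(* Composing with the projection onto [Y] lets the minimum be taken over a box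
   of the whole space. *)
pose P := projv Y.
have [C PC] := l1norm_linear_bounded P.
have cgP : continuous (g \o P).
  apply: (@l1norm_lipschitz_continuous _ _ _ C) => x y /=.
  by apply: le_trans (g_lip _ _) _; rewrite -raddfB PC.
pose M := 2 * l1norm w.
pose box := [set x : 'rV[R]_n | forall i, x 0 i \in `[- M, M]].
have box_compact : compact box.
  apply: (@rV_compact _ _ (fun=> [set` `[- M, M]])) => i.
  exact: segment_compact.
have inbox x : l1norm x <= M -> box x.
  move=> xM i; rewrite in_itv /= -ler_norml.
  exact: le_trans (ler_coord_l1norm _ _) xM.
have M0 : 0 <= M by rewrite mulr_ge0 ?l1norm_ge0.
have box0 : box 0 by apply: inbox; rewrite l1norm0.
have [||c _ cmin] := @EVT_min_rV _ _ (g \o P) box _ box_compact.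
- by exists 0.
- exact: continuous_subspaceT.
exists (g (P c)) => [|y t yY yt].
  by exists (P c) => [|v vY]; [exact: memv_proj | exact: le_g].
have [yM|/ltW My] := leP (l1norm y) M.
  apply: le_trans (g_le _ _ yt); rewrite -[X in _ <= g X](projv_id yY).
  by apply: cmin; rewrite inE; exact: inbox.
(* [y] is too long to compete with [0]: its excess at [v = 0] is already
   [>= l1norm w >= g 0]. *)
apply: (@le_trans _ _ (g 0)).
  by rewrite -[0 in leRHS](linear0 P); apply: cmin; rewrite inE.
apply: (@le_trans _ _ (l1norm w)).
  by apply: le_trans (ge_sup (E_neq0 0) (E_ub 0)) _; rewrite sub0r l1normN.
have := le_trans My (le_trans _ (yt 0 (mem0v Y))).
by rewrite !subr0 /M mulr_natl mulr2n lerD2l; exact.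
Qed.

End Compactness.

Section ZeroSet.
Variables (R : realType) (n : nat).
Implicit Types (Z : {set 'I_n}) (b u v y : 'rV[R]_n).

(** In the expansion of [v] along the basis, every term vanishes at [i]. *)
Lemma basis_zero_set (m : nat) (Y : {vspace 'rV[R]_n})
    (A : m.-tuple 'rV[R]_n) v i :
  basis_of Y A -> v \in Y -> i \in zero_set A -> v 0 i = 0.
Proof.
move=> bA vY; rewrite inE => /forallP Ai.
rewrite (coord_basis bA vY) summxE big1 // => k _.
by rewrite mxE -tnth_nth (eqP (Ai k)) mulr0.
Qed.

Lemma l1norm_sigma Z u : l1norm (sigma Z u) = \sum_(i in ~: Z) `|u 0 i|.
Proof. by rewrite big_enum_val; apply: eq_bigr => j _; rewrite mxE. Qed.

Lemma l1norm_sigma_supp Z u :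
  (forall i, i \in Z -> u 0 i = 0) -> l1norm (sigma Z u) = l1norm u.
Proof.
move=> uZ; rewrite l1norm_sigma /l1norm [RHS](bigID (mem Z)) /=.
rewrite [X in _ = X + _]big1 ?add0r => [|i iZ]; last by rewrite uZ ?normr0.
by apply: eq_bigl => i; rewrite inE.
Qed.

Lemma sigma_rho Z b : sigma Z (rho Z b) = sigma Z b.
Proof.
apply/rowP => j; rewrite !mxE; have := enum_valP j.
by rewrite inE => /negbTE ->.
Qed.

(** The identity holds coordinatewise: on [Z] both [v] and [rho Z b] vanish, and off [Z] the vectors
    [y] and [rho Z b] agree. *)
Lemma l1norm_slice Z b y v : slice Z b y ->
  (forall i, i \in Z -> v 0 i = 0) ->
  l1norm (y - v) = l1norm (rho Z b - v) + l1norm (y - rho Z b).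
Proof.
move=> yb vZ; rewrite /l1norm -big_split /=; apply: eq_bigr => i _.
rewrite !mxE; have [iZ|iZ] := boolP (i \in Z).
  by rewrite vZ // !subr0 normr0 add0r.
by rewrite yb // subrr normr0 addr0.
Qed.

End ZeroSet.

Theorem theorem2p20 (R : realType) (n m : nat) (Y : {vspace 'rV[R]_n})
    (A : m.-tuple 'rV[R]_n) (b : 'rV[R]_n)
    (A_basis : basis_of Y A)
    (r_gt0 : (0 < #|zero_set A|)%N)
    (no_coapprox : ~ exists y0 : 'rV[R]_#|~: zero_set A|,
       best_coapprox (sigma_img (zero_set A) Y) (sigma (zero_set A) b) y0) :
  exists delta0 : R, 0 < delta0 /\
    (forall y : 'rV[R]_n, slice (zero_set A) b y ->
       l1norm (y - rho (zero_set A) b) < delta0 ->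
       ~ exists y0 : 'rV[R]_n, best_coapprox Y y y0) /\
    (forall y : 'rV[R]_n, slice (zero_set A) b y ->
       delta0 <= l1norm (y - rho (zero_set A) b) ->
       exists y0 : 'rV[R]_n, best_coapprox Y y y0).
Proof.
set Z := zero_set A in no_coapprox *.
have YZ v : v \in Y -> forall i, i \in Z -> v 0 i = 0.
  by move=> vY i; exact: basis_zero_set A_basis vY.
have [d [y0 y0Y y0d] dmin] := optimal_coapprox Y (rho Z b).
have sliceE y v : slice Z b y -> v \in Y ->
    l1norm (y - v) = l1norm (rho Z b - v) + l1norm (y - rho Z b).
  by move=> yb /YZ; exact: l1norm_slice.
exists d; split; [|split].
- rewrite ltNge; apply/negP => d_le0; apply: no_coapprox.
  exists (sigma Z y0); split; first by apply/mem_sigma_img; exists y0.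
  move=> _ /mem_sigma_img[v vY ->].
  (* [b] may be nonzero on [Z], so it is first replaced by [rho Z b], which has the same image; then
     [sigma] preserves both norms. *)
  rewrite -(sigma_rho _ b) -!linearB /= !l1norm_sigma_supp.
  + by apply: le_trans (y0d v vY) _; rewrite gerDl.
  + by move=> i iZ; rewrite !mxE iZ (YZ _ vY) ?subrr.
  + by apply: YZ; rewrite memvB.
- move=> y yb yd [y1 [y1Y y1_best]].
  (* By [sliceE], a best coapproximation [y1] to [y] makes the distance from [y] to [rho Z b] an
     admissible excess, so minimality of [d] applies. *)
  move: yd; rewrite ltNge => /negP; apply; apply: dmin y1Y _ => v vY.
  by rewrite -sliceE ?y1_best.
(* The same minimizer [y0] serves for every such [y]. *)
- move=> y yb dy; exists y0; split => // v vY.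
  by apply: le_trans (y0d v vY) _; rewrite (sliceE y) ?lerD2l.
Qed.
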